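(* Let $T$ be a NIP first order theory in a language $L$ and let $M\models T$. Then every externally definable set $X\subseteq M^k$ has an honest definition.
   Context: $\mathbb M$ is a monster model of $T$ with $M\prec\mathbb M$; $L(M)$ denotes $L$-formulas with parameters from $M$; $\phi(M,d)$ is the set of tuples $a$ from $M$ such that $\mathbb M\models\phi(a,d)$. A subset $X\subseteq M^k$ is externally definable if there are an $L$-formula $\phi(x,y)$ with $|x|=k$ and a tuple $d$ from $\mathbb M$ such that $\phi(M,d)=X$; such a $\phi(x,d)$ is called a definition of $X$. An honest definition of $X$ is a definition $\phi(x,d)$ of $X$, $d\in\mathbb M$, such that $\mathbb M\models\forall x\,(\phi(x,d)\rightarrow\psi(x))$ for every $\psi(x)\in L(M)$ with $X\subseteq\psi(M)$. *)

(* Defs.v *)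
From mathcomp Require Import all_boot.
From mathcomp Require Import boolp classical_sets functions cardinality.

Set Implicit Arguments.
Unset Strict Implicit.
Unset Printing Implicit Defensive.

Local Open Scope classical_set_scope.
Local Open Scope card_scope.

Record language := Language {
  fsym : Type;
  rsym : Type;
  farity : fsym -> nat;
  rarity : rsym -> nat
}.

Inductive term (L : language) (n : nat) : Type :=
| Var of 'I_n
| App (f : fsym L) of ('I_(farity f) -> term L n).

(* [formula L n]: formulas whose free variables are among x_0, ..., x_(n-1).
   The body of a quantifier has one more variable: index 0 is the bound one,
   and the index of every other variable is shifted by one. *)
Inductive formula (L : language) (n : nat) : Type :=
| Fal
| Eq of term L n & term L n
| Rel (r : rsym L) of ('I_(rarity r) -> term L n)
| Imp of formula L n & formula L n
| All of formula L n.+1.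

Record structure (L : language) := Structure {
  carrier :> Type;
  carrier_inhabited : inhabited carrier;
  finterp : forall f : fsym L, (farity f).-tuple carrier -> carrier;
  rinterp : forall r : rsym L, (rarity r).-tuple carrier -> Prop
}.

Section Semantics.
Variable L : language.
Implicit Types M N : structure L.

Fixpoint eval N n (v : n.-tuple N) (t : term L n) : N :=
  match t with
  | Var i => tnth v i
  | App f ts => finterp [tuple eval v (ts i) | i < farity f]
  end.

Fixpoint sat N n (phi : formula L n) : n.-tuple N -> Prop :=
  match phi with
  | Fal => fun=> False
  | Eq s t => fun v => eval v s = eval v t
  | Rel r ts => fun v => rinterp [tuple eval v (ts i) | i < rarity r]
  | Imp p q => fun v => sat p v -> sat q v
  | All p => fun v => forall a : N, sat p [tuple of a :: v]
  end.

Definition theory := set (formula L 0).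

Definition models N (T : theory) : Prop :=
  forall phi, T phi -> sat phi [tuple of [::] : seq N].

(* A formula phi(x, c) with |x| = n and a tuple of parameters c from P:
   the first n variables of the body are x, the others are replaced by c. *)
Record pformula (P : Type) (n : nat) := PFormula {
  nparam : nat;
  body : formula L (n + nparam);
  param : nparam.-tuple P
}.

Definition psat N n (f : pformula N n) (a : n.-tuple N) : Prop :=
  sat (body f) [tuple of a ++ param f].

Definition pmap_param P Q (h : P -> Q) n (f : pformula P n) : pformula Q n :=
  PFormula (body f) (map_tuple h (param f)).

(* M is identified with its image under the elementary embedding j. *)
Definition elementary M N (j : M -> N) : Prop :=
  forall n (phi : formula L n) (v : n.-tuple M),
    sat phi v <-> sat phi (map_tuple j v).

(* phi(x, y) with |x| = n and |y| = m has the independence property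
   modulo T. *)
Definition has_IP (T : theory) n m (phi : formula L (n + m)) : Prop :=
  exists N : structure L, models N T /\
  exists (a : nat -> n.-tuple N) (b : set nat -> m.-tuple N),
    forall i I, sat phi [tuple of a i ++ b I] <-> I i.

Definition NIP (T : theory) : Prop :=
  forall n m (phi : formula L (n + m)), ~ has_IP T phi.

(* |A| < |K|; the type K plays the role of a cardinal kappa. *)
Definition small (K P : Type) (A : set P) : Prop := ~ ([set: K] #<= A).

Definition over N (A : set N) n (f : pformula N n) : Prop :=
  forall i, A (tnth (param f) i).

Definition realizes N n (p : set (pformula N n)) (a : n.-tuple N) : Prop :=
  forall f, p f -> psat f a.

Definition saturated (K : Type) N : Prop :=
  forall (A : set N) n (p : set (pformula N n)),
    small K A -> (forall f, p f -> over A f) ->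
    (forall q, finite_set q -> q `<=` p -> exists a, realizes q a) ->
    exists a, realizes p a.

Definition elementary_on N (A : set N) (h : N -> N) : Prop :=
  forall n (phi : formula L n) (v : n.-tuple N),
    (forall i, A (tnth v i)) -> (sat phi v <-> sat phi (map_tuple h v)).

Definition automorphism N (s : N -> N) : Prop :=
  [/\ bijective s,
      forall (f : fsym L) (v : (farity f).-tuple N),
        s (finterp v) = finterp (map_tuple s v)
    & forall (r : rsym L) (v : (rarity r).-tuple N),
        rinterp v <-> rinterp (map_tuple s v)].

Definition strongly_homogeneous (K : Type) N : Prop :=
  forall (A : set N) (h : N -> N), small K A -> elementary_on A h ->
    exists2 s : N -> N, automorphism s & forall x, A x -> s x = h x.

(* The second condition says kappa > |L| + aleph_0. *)
Definition monster_model (K : Type) (T : theory) N : Prop :=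
  [/\ models N T, small K [set: {n & formula L n}],
      saturated K N & strongly_homogeneous K N].

Section ExternallyDefinable.
Variables (M N : structure L) (j : M -> N).

(* phi(M, d), the set of tuples from M satisfying phi(x, d) in N *)
Definition trace k (f : pformula N k) : set (k.-tuple M) :=
  [set a | psat f (map_tuple j a)].

Definition definition_of k (f : pformula N k) (X : set (k.-tuple M)) : Prop :=
  trace f = X.

Definition externally_definable k (X : set (k.-tuple M)) : Prop :=
  exists f : pformula N k, definition_of f X.

Definition honest_definition k (f : pformula N k) (X : set (k.-tuple M)) :
    Prop :=
  definition_of f X /\
  forall psi : pformula M k, X `<=` trace (pmap_param j psi) ->
    forall x : k.-tuple N, psat f x -> psat (pmap_param j psi) x.

End ExternallyDefinable.

End Semantics.

(* Main.v *)
(* Call S <= X approximable if there is a formula theta(x, y) such that every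
   finite X0 <= S satisfies X0 <= theta(M, e) <= X for some e from M.  If X itself
   is approximable, saturation over M yields e in the monster model that works
   for all of X, and it can be required that theta(x, e) implies every psi over M
   that contains X: this is an honest definition.

   Approximable sets form an ideal.  If X is not in it, build c_0, c_1, ... in
   the monster model such that every formula chi(c_0, ..., c_(n-1), x) over M
   true of c_n has a non-approximable trace on X.  By induction on n, every
   formula over M true of c_0, ..., c_(n-1) is true of some a_0, ..., a_(n-1) in M
   with any prescribed pattern of membership in X.  If X = phi(M, d), then d
   realizes this pattern on the a_i, so the c_i must be shattered by phi,
   contradicting NIP. *)

Require Import Defs.
From mathcomp Require Import all_boot.
From mathcomp Require Import boolp classical_sets functions cardinality.

Set Implicit Arguments.
Unset Strict Implicit.
Unset Printing Implicit Defensive.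

Local Open Scope classical_set_scope.

(** * Finite sets, and sets of size below [K] *)

Section Cardinality.
Local Open Scope card_scope.

Lemma finite_set_ind (T : Type) (P : set T -> Prop) :
  P set0 -> (forall x A, finite_set A -> P A -> P (x |` A)) ->
  forall A, finite_set A -> P A.
Proof.
(* Listing a finite set by a sequence needs decidable equality, which [{classic T}] supplies. *)
move=> P0 PS A; rewrite -[T]/(Choice.sort {classic T}) in P P0 PS A *.
move=> /finite_seqP[s ->]; elim: s => [|x s IHs].
  by rewrite set_nil.
have -> : [set` x :: s] = x |` [set` s].
  apply/seteqP; split=> y /=; rewrite inE; first by case/orP => [/eqP|]; [left|right].
  by case=> [->|->]; rewrite ?eqxx ?orbT.
by apply: PS => //; exact: finite_seq.
Qed.

Lemma sub_small (K P Q : Type) (A : set P) (B : set Q) :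
  A #<= B -> small K B -> small K A.
Proof. by move=> AB sB KA; apply: sB; exact: card_le_trans KA AB. Qed.

(** Hilbert's hotel: move each point of an embedded copy of [nat] to the next one and fix everything
    else; the point [g 0] is freed. *)
Lemma shift_injection (K : Type) :
  infinite_set [set: K] ->
  exists (k : K) (h : K -> K), injective h /\ forall y, h y <> k.
Proof.
move=> Kinf.
have [g ginj] : exists g : nat -> K, injective g.
  have [k0 _] := infinite_setN0 Kinf.
  move/infiniteP/card_leP: Kinf => [g].
  have /injfunPex[f _ finj] : $|{injfun [set: nat] >-> [set: K]}|.
    by squash (valLR k0 g).
  by exists f => m n; apply: finj; rewrite in_setT.
pose h y := if pselect (exists n, y = g n) is left e
            then g (projT1 (cid e)).+1 else y.
exists (g 0), h; split=> [y y'|y]; rewrite /h.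
  case: pselect => [e|n]; case: pselect => [e'|n'] //.
  - case: (cid e) => m /= yE; case: (cid e') => m' /= yE' /ginj [mm].
    by rewrite yE yE' mm.
  - by move=> yE; case: n'; eexists; exact/esym/yE.
  - by move=> yE; case: n; eexists; exact: yE.
case: pselect => [e /ginj//|n yE].
by apply: n; exists 0.
Qed.

(** An injection [F] of [K] into the enlarged set can be pushed into [A]: precompose with the shift
    [h], which frees the value [F k], and use that value wherever [z] would be taken. *)
Lemma small_setU1 (K P : Type) (z : P) (A : set P) :
  small K [set: nat] -> small K A -> small K (z |` A).
Proof.
move=> Knat KA /card_leP[f].
have [k [h [hinj hk]]] : exists (k : K) (h : K -> K),
    injective h /\ forall y, h y <> k.
  by apply: shift_injection => /finite_set_countable.
have /injfunPex[F Ffun Finj] : $|{injfun [set: K] >-> z |` A}|.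
  by squash (valLR z f).
have {}Finj : injective F by move=> x y; apply: Finj; rewrite in_setT.
pose G y := if `[< F (h y) = z >] then F k else F (h y).
have /injfunPex[G'] : exists2 G : K -> P, set_fun setT A G & set_inj setT G.
  exists G => [y _|y y' _ _]; rewrite /G.
    case: asboolP => [hz|]; last by case: (Ffun (h y) I).
    by have [Fk|//] := Ffun k I; case: (hk y); apply: Finj; rewrite hz Fk.
  case: asboolP => [hz|hz]; case: asboolP => [hz'|hz'].
  - by move=> _; apply/hinj/Finj; rewrite hz hz'.
  - by move=> /Finj /esym /hk.
  - by move=> /Finj /hk.
  - by move=> /Finj /hinj.
exact: KA (inj_card_le G').
Qed.

Lemma small_setU (K P : Type) (A B : set P) :
  small K [set: nat] -> small K A -> finite_set B -> small K (B `|` A).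
Proof.
move=> Knat KA; move: B; apply: finite_set_ind => [|x B _ KB].
  by rewrite set0U.
by rewrite -setUA; exact: small_setU1.
Qed.

End Cardinality.

(** * Substitution, quantification and saturation for formulas with arbitrary variable types *)

Section Formulas.
Variable L : language.
Implicit Types N : structure L.

Fixpoint trename n m (r : 'I_n -> 'I_m) (t : term L n) : term L m :=
  match t with
  | Var i => Var L (r i)
  | App f ts => App (fun i => trename r (ts i))
  end.

Definition rename_up n m (r : 'I_n -> 'I_m) (i : 'I_n.+1) : 'I_m.+1 :=
  if unlift ord0 i is Some i' then lift ord0 (r i') else ord0.

Fixpoint rename n (phi : formula L n) : forall m, ('I_n -> 'I_m) -> formula L m :=
  match phi with
  | Fal => fun m _ => Fal L m
  | Eq s t => fun m r => Eq (trename r s) (trename r t)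
  | Rel R ts => fun m r => Rel (fun i => trename r (ts i))
  | Imp p q => fun m r => Imp (rename p r) (rename q r)
  | All p => fun m r => All (rename p (rename_up r))
  end.

Lemma eval_trename N n m (r : 'I_n -> 'I_m) (t : term L n) (w : m.-tuple N) :
  eval w (trename r t) = eval [tuple tnth w (r i) | i < n] t.
Proof.
elim: t => [i|f ts IH] /=; first by rewrite tnth_mktuple.
by congr finterp; apply: eq_from_tnth => i; rewrite !tnth_mktuple IH.
Qed.

Lemma sat_rename N n (phi : formula L n) m (r : 'I_n -> 'I_m) (w : m.-tuple N) :
  sat (rename phi r) w <-> sat phi [tuple tnth w (r i) | i < n].
Proof.
elim: phi m r w => {n} [n|n s t|n R ts|n p IHp q IHq|n p IHp] m r w //=.
- by rewrite !eval_trename.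
- by under [X in rinterp X]eq_mktuple do rewrite eval_trename.
- by rewrite IHp IHq.
- suff E (a : N) : [tuple tnth [tuple of a :: w] (rename_up r i) | i < n.+1] =
                   [tuple of a :: [tuple tnth w (r i) | i < n]].
    by split=> H a; move: (H a); rewrite IHp E.
  apply: eq_from_tnth => i; rewrite tnth_mktuple /rename_up.
  case: unliftP => [i' ->|->]; last by rewrite !tnth0.
  by rewrite !tnthS tnth_mktuple.
Qed.

(* Formulas whose free variables are indexed by an arbitrary type: parameters
   from M are handled as variables indexed by M, and substitution reduces to
   composition with a map of variable types. *)
Record vform (V : Type) := VForm {
  vsize : nat;
  vbody : formula L vsize;
  vvar : 'I_vsize -> V
}.
Arguments vvar {V} _ _.

Definition vsat N V (v : V -> N) (f : vform V) : Prop :=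
  sat (vbody f) [tuple v (vvar f i) | i < vsize f].

Definition vren V W (g : V -> W) (f : vform V) : vform W :=
  VForm (vbody f) (g \o vvar f).

Definition vfalse V (v0 : V) : vform V := VForm (Fal L 1) (fun=> v0).

Definition sumf A B C (f : A -> C) (g : B -> C) (x : A + B) : C :=
  match x with inl a => f a | inr b => g b end.

Definition vimp V (f g : vform V) : vform V :=
  VForm (Imp (rename (vbody f) (@lshift (vsize f) (vsize g)))
             (rename (vbody g) (@rshift (vsize f) (vsize g))))
        (sumf (vvar f) (vvar g) \o @fintype.split _ _).

Definition vnot V (f : vform V) : vform V := VForm (Imp (vbody f) (Fal L _)) (vvar f).

Lemma splitl m n (i : 'I_m) : fintype.split (lshift n i) = inl i.
Proof. exact: (unsplitK (inl i)). Qed.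

Lemma splitr m n (i : 'I_n) : fintype.split (rshift m i) = inr i.
Proof. exact: (unsplitK (inr i)). Qed.

Section VSat.
Variables (N : structure L) (V : Type) (v : V -> N).

Lemma vsat_imp f g : vsat v (vimp f g) <-> (vsat v f -> vsat v g).
Proof.
rewrite /vsat /vimp /= !sat_rename.
have -> : [tuple tnth [tuple v (sumf (vvar f) (vvar g) (fintype.split i)) | i < _]
             (lshift (vsize g) i) | i < vsize f] = [tuple v (vvar f i) | i < _].
  by apply: eq_from_tnth => i; rewrite !tnth_mktuple splitl.
have -> : [tuple tnth [tuple v (sumf (vvar f) (vvar g) (fintype.split i)) | i < _]
             (rshift (vsize f) i) | i < vsize g] = [tuple v (vvar g i) | i < _].
  by apply: eq_from_tnth => i; rewrite !tnth_mktuple splitr.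
by [].
Qed.

Lemma vsat_not f : vsat v (vnot f) <-> ~ vsat v f.
Proof. by []. Qed.

End VSat.

(** Binary conjunction is coded as the negation of [f -> ~ g]. The formula [g] is chosen before [N]
    and [v], so the same conjunction can be read in [M] and in the monster model. *)
Lemma vbigand (V : Type) (v0 : V) (q : set (vform V)) : finite_set q ->
  exists g, forall N (v : V -> N), vsat v g <-> forall f, q f -> vsat v f.
Proof.
move: q; apply: finite_set_ind => [|f q _ [g Hg]].
  by exists (vnot (vfalse v0)) => N v; split=> // _ [].
exists (vnot (vimp f (vnot g))) => N v.
rewrite vsat_not vsat_imp vsat_not Hg; split=> [H h [->|qh]|H].
- by apply: contrapT => nf; apply: H.
- by apply: contrapT => nh; apply: H => _ /(_ h qh).
- by move=> /(_ (H f _)); apply; [left|move=> h qh; apply: H; right].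
Qed.

Lemma tnth_mktupleE N n (x : 'I_n -> N) : tnth [tuple x i | i < n] = x.
Proof. by apply/funext => i; rewrite tnth_mktuple. Qed.

Section Blocks.
Variables (V : Type) (m : nat).

Definition vform_of_pform (f : pformula L V m) : vform (V + 'I_m) :=
  VForm (body f) (fun i => match fintype.split i with
                           | inl l => inr l
                           | inr l => inl (tnth (param f) l)
                           end).

Lemma vsat_vform_of_pform N (v : V -> N) (f : pformula L V m) (x : m.-tuple N) :
  vsat (sumf v (tnth x)) (vform_of_pform f) <-> psat (pmap_param v f) x.
Proof.
rewrite /vsat /psat /=; set t := mktuple _; set u := tuple _.
suff -> : t = u by [].
apply: eq_from_tnth => i; rewrite tnth_mktuple -[i]splitK.
case: (fintype.split i) => l /=; first by rewrite splitl tnth_lshift.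
by rewrite splitr tnth_rshift tnth_map.
Qed.

(** Every slot of [f] gets a parameter position of its own; the positions of slots that hold a block
    variable do not occur in the renamed body and are filled with [v0]. *)
Definition pform_of_vform (v0 : V) (f : vform (V + 'I_m)) : pformula L V m :=
  PFormula
    (rename (vbody f) (fun i => match vvar f i with
                                | inl _ => rshift m i
                                | inr l => lshift (vsize f) l
                                end))
    [tuple (if vvar f i is inl a then a else v0) | i < vsize f].

Lemma psat_pform_of_vform N (v : V -> N) v0 (f : vform (V + 'I_m))
    (x : m.-tuple N) :
  psat (pmap_param v (pform_of_vform v0 f)) x <-> vsat (sumf v (tnth x)) f.
Proof.
rewrite /psat /vsat /= sat_rename; set t := mktuple _; set u := mktuple _.
suff -> : t = u by [].
apply: eq_from_tnth => i; rewrite !tnth_mktuple.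
case E : (vvar f i) => [a|l]; last by rewrite tnth_lshift.
by rewrite tnth_rshift tnth_map tnth_mktuple E.
Qed.

Fixpoint Alls n p : formula L (p + n) -> formula L n :=
  match p with
  | 0 => id
  | p'.+1 => fun phi => Alls (All phi)
  end.

Lemma sat_Alls N n p (phi : formula L (p + n)) (w : n.-tuple N) :
  sat (Alls phi) w <-> forall x : p.-tuple N, sat phi [tuple of x ++ w].
Proof.
elim: p phi => [|p IH] phi /=.
  have E (x : 0.-tuple N) : [tuple of x ++ w] = w.
    by apply: val_inj => /=; rewrite (tuple0 x).
  by split=> [H x|/(_ [tuple])]; rewrite E.
rewrite IH /=.
have E a (x : p.-tuple N) :
    [tuple of a :: [tuple of x ++ w]] = [tuple of [tuple of a :: x] ++ w].
  exact: val_inj.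
split=> [H x|H x a]; last by rewrite E.
by case/tupleP: x => a x; rewrite -E.
Qed.

(** [pform_of_vform] brings the block ['I_m] to the front, where [Alls] can bind it; the parameters
    become the free variables. *)
Definition vall (v0 : V) (f : vform (V + 'I_m)) : vform V :=
  VForm (Alls (body (pform_of_vform v0 f))) (tnth (param (pform_of_vform v0 f))).

Lemma vsat_all N (v : V -> N) v0 (f : vform (V + 'I_m)) :
  vsat v (vall v0 f) <-> forall x : 'I_m -> N, vsat (sumf v x) f.
Proof.
rewrite /vsat sat_Alls.
have E (x : m.-tuple N) : vsat (sumf v (tnth x)) f <->
   sat (body (pform_of_vform v0 f)) [tuple of x ++
     [tuple v (vvar (vall v0 f) i) | i < vsize (vall v0 f)]].
  rewrite -(psat_pform_of_vform v v0) /psat.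
  suff -> : param (pmap_param v (pform_of_vform v0 f)) =
    [tuple v (vvar (vall v0 f) i) | i < vsize (vall v0 f)] by [].
  by apply: eq_from_tnth => i; rewrite tnth_mktuple tnth_map.
split=> H x; last exact/E.
by rewrite -(tnth_mktupleE x); apply/E.
Qed.

Lemma saturated_vform (K : Type) N (v : V -> N) (v0 : V)
    (F : set (vform (V + 'I_m))) :
  saturated K N -> small K (range v) ->
  (forall q, finite_set q -> q `<=` F ->
    exists x, forall f, q f -> vsat (sumf v x) f) ->
  exists x, forall f, F f -> vsat (sumf v x) f.
Proof.
move=> satN sv Ffin.
pose tr f := pmap_param v (pform_of_vform v0 f).
have [|q qfin qF|x xF] := satN (range v) m (tr @` F) sv.
- by move=> _ [f _ <-] i; rewrite /= tnth_map; eexists.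
(* A section of [tr] over [q] turns the finite part [q] of the translated type into a finite part of
   [F]. *)
- have [s Hs] : exists s, forall g, q g -> F (s g) /\ tr (s g) = g.
    suff /choice[s Hs] : forall g, exists f, q g -> F f /\ tr f = g by exists s.
    move=> g; have [/qF[f]|ng] := pselect (q g); first by exists f.
    by exists (VForm (Fal L 0) (fun i => inl v0)).
  have [|x Hx] := Ffin (s @` q) (finite_image s qfin).
    by move=> _ [g /Hs[]] + _ <-.
  exists [tuple x i | i < m] => g qg; have [_ <-] := Hs g qg.
  by apply/psat_pform_of_vform; rewrite tnth_mktupleE; apply: Hx; exists g.
- exists (tnth x) => f Ff; apply/(psat_pform_of_vform _ v0); apply: xF.
  by exists f.
Qed.

End Blocks.

Lemma pmap_param_id P n (f : pformula L P n) : pmap_param id f = f.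
Proof.
case: f => p phi a; rewrite /pmap_param /=.
by have -> : map_tuple id a = a by apply: eq_from_tnth => i; rewrite tnth_map.
Qed.

Lemma vsat_elementary (M N : structure L) (j : M -> N) V (v : V -> M)
    (f : vform V) :
  elementary j -> vsat v f <-> vsat (j \o v) f.
Proof.
move=> /(_ _ (vbody f)) H; rewrite /vsat H.
suff -> : map_tuple j [tuple v (vvar f i) | i < vsize f] =
          [tuple (j \o v) (vvar f i) | i < vsize f] by [].
by apply: eq_from_tnth => i; rewrite tnth_map !tnth_mktuple.
Qed.

Lemma vsat_vren N V W (v : W -> N) (g : V -> W) (w : V -> N) (f : vform V) :
  (forall y, v (g y) = w y) -> vsat v (vren g f) <-> vsat w f.
Proof. by move=> /funext <-. Qed.

End Formulas.
Arguments vvar {L V} _ _.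

(** * The ideal of approximable sets, and honest definitions *)

Section HonestDefinitions.
Variables (L : language) (K : Type) (M MM : structure L) (j : M -> MM) (k : nat).
Hypotheses (satMM : saturated K MM) (KM : small K [set: M])
  (jE : elementary j).
Variable X : set ('I_k -> M).
Implicit Types (m : 'I_k -> M) (S : set ('I_k -> M)).

(** The parameter variables form an arbitrary type [E], so that sums of such types, or all the
    variables of a given formula, can serve without renumbering. *)
Definition approximable S : Prop :=
  exists (E : Type) (th : vform L (E + 'I_k)),
    forall X0, finite_set X0 -> X0 `<=` S ->
    exists2 e : E -> M, (forall m, X0 m -> vsat (sumf e m) th)
                      & (forall m, vsat (sumf e m) th -> X m).

Lemma approximable0 : approximable set0.
Proof.
have [m0] := carrier_inhabited M.
exists unit, (vfalse L (inl tt)) => X0 _ X00.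
by exists (fun=> m0) => // m /X00.
Qed.

Lemma sub_approximable S S' : S `<=` S' -> approximable S' -> approximable S.
Proof.
move=> SS' [E [th H]]; exists E, th => X0 X0fin X0S.
by apply: H => //; apply: subset_trans SS'.
Qed.

(** The disjunction of the two formulas works, with disjoint parameter variables and coded as
    [~ t -> t']; a finite subset of the union is split into its traces on [S] and [S']. *)
Lemma approximableU S S' :
  approximable S -> approximable S' -> approximable (S `|` S').
Proof.
move=> [E [th H]] [E' [th' H']].
pose t := vren (sumf (inl \o inl) inr) th : vform L ((E + E') + 'I_k).
pose t' := vren (sumf (inl \o inr) inr) th' : vform L ((E + E') + 'I_k).
exists (E + E')%type, (vimp (vnot t) t') => X0 X0fin X0S.
have [e He eX] := H (X0 `&` S) (finite_setIl S X0fin) (@subIsetr _ _ _).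
have [e' He' eX'] := H' (X0 `&` S') (finite_setIl S' X0fin) (@subIsetr _ _ _).
have Et m : vsat (sumf (sumf e e') m) t <-> vsat (sumf e m) th.
  by apply: vsat_vren => -[].
have Et' m : vsat (sumf (sumf e e') m) t' <-> vsat (sumf e' m) th'.
  by apply: vsat_vren => -[].
exists (sumf e e') => m.
  move=> X0m; apply/vsat_imp; rewrite vsat_not Et Et'.
  by case: (X0S m X0m) => Sm; [case; exact: He | move=> _; exact: He'].
move=> /vsat_imp; rewrite vsat_not Et Et' => tt'.
by have [/eX//|/tt'/eX'] := pselect (vsat (sumf e m) th).
Qed.

Lemma approximable_bigcup (I : Type) (D : I -> set ('I_k -> M)) (q : set I) :
  finite_set q -> (forall i, q i -> approximable (D i)) ->
  approximable (\bigcup_(i in q) D i).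
Proof.
move: q; apply: finite_set_ind => [|i q _ IH] qD.
  by rewrite bigcup_set0; exact: approximable0.
rewrite bigcup_setU1; apply: approximableU; first by apply: qD; left.
by apply: IH => l ql; apply: qD; right.
Qed.

(** A formula has finitely many slots, so one parameter variable per slot is enough; slots occupied
    by [x] get the default value [m0]. *)
Lemma approximable_ord S : approximable S ->
  exists p (th : vform L ('I_p + 'I_k)),
    forall X0, finite_set X0 -> X0 `<=` S ->
    exists2 e : 'I_p -> M, (forall m, X0 m -> vsat (sumf e m) th)
                         & (forall m, vsat (sumf e m) th -> X m).
Proof.
move=> [E [th H]]; have [m0] := carrier_inhabited M.
exists (vsize th), (VForm (vbody th) (fun i =>
  match vvar th i with inl _ => inl i | inr l => inr l end)).
move=> X0 X0fin X0S; have [e He eX] := H X0 X0fin X0S.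
pose e' i := if vvar th i is inl a then e a else m0.
suff Ee m : vsat (sumf e' m) (VForm (vbody th) (fun i =>
    match vvar th i with inl _ => inl i | inr l => inr l end)) <->
    vsat (sumf e m) th.
  by exists e' => m; rewrite Ee; [exact: He|exact: eX].
rewrite /vsat /=; set t := mktuple _; set u := mktuple _.
suff -> : t = u by [].
apply: eq_from_tnth => i; rewrite !tnth_mktuple.
by case E1 : (vvar th i) => [a|l] //=; rewrite /e' E1.
Qed.

Lemma honest_of_approximable : approximable X ->
  exists f : pformula L MM k,
    (forall m, psat f [tuple j (m i) | i < k] <-> X m) /\
    forall psi : vform L (M + 'I_k),
      (forall m, X m -> vsat (sumf id m) psi) ->
      forall x : k.-tuple MM, psat f x -> vsat (sumf j (tnth x)) psi.
Proof.
move=> /approximable_ord[p [th H]].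
have [m0] := carrier_inhabited M.
pose pos m : vform L (M + 'I_p) := vren (sumf inr (inl \o m)) th.
pose hon psi : vform L (M + 'I_p) := vall (inl m0)
  (vimp (vren (sumf (inl \o inr) inr) th) (vren (sumf (inl \o inl) inr) psi)).
have Epos (N : structure L) (h : M -> N) y m :
    vsat (sumf h y) (pos m) <-> vsat (sumf y (h \o m)) th.
  by apply: vsat_vren => -[].
have Ehon (N : structure L) (h : M -> N) y psi : vsat (sumf h y) (hon psi) <->
    forall x, vsat (sumf y x) th -> vsat (sumf h x) psi.
  have Eth x : vsat (sumf (sumf h y) x) (vren (sumf (inl \o inr) inr) th) <->
      vsat (sumf y x) th by apply: vsat_vren => -[].
  have Epsi x : vsat (sumf (sumf h y) x) (vren (sumf (inl \o inl) inr) psi) <->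
      vsat (sumf h x) psi by apply: vsat_vren => -[].
  by rewrite vsat_all; split=> H1 x; move: (H1 x); rewrite vsat_imp Eth Epsi.
(* The type of the parameter [y]: the first two kinds of conditions make [th(x, y)] define [X], the
   third makes it honest. *)
pose F : set (vform L (M + 'I_p)) :=
  [set g | [\/ exists2 m, X m & g = pos m,
               exists2 m, ~ X m & g = vnot (pos m)
             | exists2 psi, (forall m, X m -> vsat (sumf id m) psi)
                          & g = hon psi]].
(* Only conditions [pos m] with [m] in [X] constrain the choice of [X0]; the other two kinds hold in
   [M] for every [e] with [th(M, e)] inside [X]. *)
have Ffin q : finite_set q -> q `<=` F ->
    exists X0, [/\ finite_set X0, X0 `<=` X & forall e : 'I_p -> M,
      (forall m, X0 m -> vsat (sumf e m) th) ->
      (forall m, vsat (sumf e m) th -> X m) ->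
      forall g, q g -> vsat (sumf id e) g].
  move: q; apply: finite_set_ind => [_|g q _ IH gqF].
    by exists set0; split=> // [|_ _ _ _ []]; exact: sub0set.
  have [|X0 [X0fin X0X HX0]] := IH; first by move=> l ql; apply: gqF; right.
  case: (gqF g (or_introl erefl)) => [[m Xm gE]|[m Xm gE]|[psi Hpsi gE]].
  - exists (m |` X0); split=> [||e He eX g' [->|]].
    + by rewrite finite_setU; split=> //; exact: finite_set1.
    + by move=> m' [->|/X0X].
    + by rewrite gE; apply/Epos; apply: He; left.
    + by apply: HX0 => // l Hl; apply: He; right.
  - exists X0; split=> // e He eX g' [->|]; last exact: HX0.
    by rewrite gE; apply/vsat_not => /Epos/eX.
  - exists X0; split=> // e He eX g' [->|]; last exact: HX0.
    by rewrite gE; apply/Ehon => m /eX/Hpsi.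
have [|q qfin qF|y yF] := @saturated_vform L M p K MM j m0 F satMM.
- exact: sub_small (card_image_le _ _) KM.
- have [X0 [X0fin X0X HX0]] := Ffin q qfin qF.
  have [e He eX] := H X0 X0fin X0X.
  exists (j \o e) => g qg; have := HX0 e He eX g qg.
  rewrite (vsat_elementary _ _ jE).
  by have -> : j \o sumf id e = sumf j (j \o e) by apply/funext => -[].
pose f := pform_of_vform (j m0) (vren (sumf (inl \o y) inr) th).
have Ef (x : k.-tuple MM) : psat f x <-> vsat (sumf y (tnth x)) th.
  by rewrite -(pmap_param_id f) psat_pform_of_vform; apply: vsat_vren => -[].
exists f; split=> [m|psi Hpsi x /Ef].
  rewrite Ef tnth_mktupleE; split=> [|Xm].
    move=> /(Epos MM j y m) yth; apply: contrapT => nXm.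
    have : vsat (sumf j y) (vnot (pos m)) by apply: yF; apply: Or32; exists m.
    exact.
  by apply/(Epos MM j y m); apply: yF; apply: Or31; exists m.
have /Ehon : vsat (sumf j y) (hon psi) by apply: yF; apply: Or33; exists psi.
exact.
Qed.

(* The variable [inl m] stands for the element m of M, the variable
   [inr (i, l)] for the l-th coordinate of the i-th tuple of a sequence. *)
Local Notation V := (M + nat * 'I_k)%type.

(** * Generic sequences and their patterns of membership in [X] *)

Definition env N (h : M -> N) (c : nat -> 'I_k -> N) : V -> N :=
  sumf h (fun p => c p.1 p.2).

Definition upd N (c : nat -> 'I_k -> N) n (x : 'I_k -> N) : nat -> 'I_k -> N :=
  fun i => if i == n then x else c i.

(** The syntactic counterpart of [upd]: the [n]-th tuple is replaced either by constants of [M] or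
    by a fresh block of variables. *)
Definition subst_at W n (f : V -> W) (g : 'I_k -> W) (y : V) : W :=
  if y is inr (i, l) then if i == n then g l else f y else f y.

Lemma vsat_subst_at (N : structure L) (h : M -> N) c n x W (v : W -> N) f g chi :
  (forall y, v (f y) = env h c y) -> (forall l, v (g l) = x l) ->
  vsat v (vren (subst_at n f g) chi) <-> vsat (env h (upd c n x)) chi.
Proof.
move=> vf vg; apply: vsat_vren => -[m|[i l]] /=; first by rewrite vf.
by rewrite /upd; case: eqP => // _; rewrite vf.
Qed.

Definition subst_const n m : V -> V := subst_at n id (fun l => inl (m l)).

Lemma vsat_subst_const (N : structure L) (h : M -> N) c n m (chi : vform L V) :
  vsat (env h c) (vren (subst_const n m) chi) <->
  vsat (env h (upd c n (h \o m))) chi.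
Proof. exact: vsat_subst_at. Qed.

Lemma vsat_subst_free (N : structure L) (h : M -> N) c n x (chi : vform L V) :
  vsat (sumf (env h c) x) (vren (subst_at n inl inr) chi) <->
  vsat (env h (upd c n x)) chi.
Proof. exact: vsat_subst_at. Qed.

Definition generic_at (c : nat -> 'I_k -> MM) n (x : 'I_k -> MM) : Prop :=
  forall chi : vform L V, vsat (env j (upd c n x)) chi ->
    ~ approximable [set m | X m /\ vsat (env j (upd c n (j \o m))) chi].

(** The wanted [x] realizes the negations of all [chi] with approximable trace. If no point of [X]
    realized some finitely many of them, their traces would cover [X], and [X] would be
    approximable. *)
Lemma generic_exists c n :
  small K (range (env j c)) -> ~ approximable X -> exists x, generic_at c n x.
Proof.
move=> cK nX; have [m0] := carrier_inhabited M.
pose D (chi : vform L V) :=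
  [set m | X m /\ vsat (env j (upd c n (j \o m))) chi].
pose F : set (vform L (V + 'I_k)) := [set g | exists2 chi, approximable (D chi) &
  g = vnot (vren (subst_at n inl inr) chi)].
have [q qfin qF|x xF] := @saturated_vform L V k K MM (env j c) (inl m0) F satMM cK.
- pose D' g := [set m | X m /\ ~ vsat (sumf (env j c) (j \o m)) g].
  have [m [Xm Hm]] : exists m, X m /\ ~ (\bigcup_(g in q) D' g) m.
    apply: contrapT => H; apply: nX.
    apply: (@sub_approximable _ (\bigcup_(g in q) D' g)).
      by move=> m Xm; apply: contrapT => Hm; apply: H; exists m.
    apply: approximable_bigcup => // g /qF[chi chiD ->].
    apply: sub_approximable chiD => m [Xm nn]; split=> //.
    by apply/vsat_subst_free; apply: contrapT.
  exists (j \o m) => g qg; apply: contrapT => ng.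
  by apply: Hm; exists g.
- exists x => chi Hchi chiD.
  have : vsat (sumf (env j c) x) (vnot (vren (subst_at n inl inr) chi)).
    by apply: xF; exists chi.
  by move/vsat_not; apply; apply/vsat_subst_free.
Qed.

(** Formulas over [V] may mention every term of the sequence; with [z] taken from [M], the terms
    from [n] on carry no more than constants of [M]. *)
Definition trunc (z : MM) (c : nat -> 'I_k -> MM) n : nat -> 'I_k -> MM :=
  fun i => if i < n then c i else fun=> z.

Lemma truncS z c n : trunc z c n.+1 = upd (trunc z c n) n (c n).
Proof.
apply/funext => i; rewrite /trunc /upd ltnS leq_eqVlt.
by case: eqP => [->|].
Qed.

Lemma generic_sequence z : small K [set: nat] -> range j z ->
  ~ approximable X -> exists c, forall n, generic_at (trunc z c n) n (c n).
Proof.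
move=> Knat jz nX.
have [g gP] : exists g : (nat -> 'I_k -> MM) * nat -> 'I_k -> MM,
    forall p, small K (range (env j p.1)) -> generic_at p.1 p.2 (g p).
  suff /choice[g gP] : forall p : (nat -> 'I_k -> MM) * nat, exists x,
    small K (range (env j p.1)) -> generic_at p.1 p.2 x by exists g.
  move=> [c n]; have [cK|ncK] := pselect (small K (range (env j c))).
    by have [x Hx] := generic_exists n cK nX; exists x.
  by exists (fun=> z).
(* [pre n] holds the first [n] terms and [z] afterwards. Each stage adds only the finitely many
   coordinates of one tuple, so the parameter set stays small. *)
pose pre := fix pre n : nat -> 'I_k -> MM :=
  if n is n'.+1 then upd (pre n') n' (g (pre n', n')) else fun _ _ => z.
have preK n : small K (range (env j (pre n))).
  elim: n => [|n IH] /=.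
    have jK : small K (range j) := sub_small (card_image_le j _) KM.
    apply: sub_small jK; apply: subset_card_le.
    by move=> _ [[m|p] _ <-] //=; exists m.
  have xfin : finite_set (range (g (pre n, n))).
    by apply: finite_image; exact: finite_finset.
  apply: sub_small (small_setU Knat IH xfin).
  apply: subset_card_le => _ [[m|[i l]] _ <-] /=; first by right; exists (inl m).
  rewrite /upd; case: eqP => _; first by left; exists l.
  by right; exists (inr (i, l)).
pose c n := g (pre n, n).
have truncE n : trunc z c n = pre n.
  elim: n => [|n IH]; first exact: funext.
  by rewrite truncS IH.
by exists c => n; rewrite truncE; exact: gP (pre n, n) (preK n).
Qed.

(* The n-th term m is chosen before the others, and chi(c_<n, m) is passed to the
   induction hypothesis. If no n-th term outside X works, then chi itself, with
   the earlier terms as parameters, witnesses approximability. *)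
Lemma generic_patterns (m0 : M) c (I : set nat) n (chi : vform L V) :
  (forall n, generic_at (trunc (j m0) c n) n (c n)) ->
  vsat (env j (trunc (j m0) c n)) chi ->
  exists a, vsat (env id a) chi /\ forall i, i < n -> (X (a i) <-> I i).
Proof.
move=> gen; elim: n chi => [|n IH] chi.
  (* Every term is [j m0] here, so [chi] speaks of elements of [M] only. *)
  move=> H; exists (fun _ _ => m0); split=> //.
  apply/(vsat_elementary _ _ jE).
  suff <- : env j (trunc (j m0) c 0) = j \o env id (fun _ _ => m0) by [].
  by apply/funext => -[|[]].
rewrite truncS => /gen nS.
pose S := [set m | X m /\ vsat (env j (upd (trunc (j m0) c n) n (j \o m))) chi].
have extend a m : vsat (env id (upd a n m)) chi -> (X m <-> I n) ->
    (forall i, i < n -> (X (a i) <-> I i)) ->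
    exists a, vsat (env id a) chi /\ forall i, i < n.+1 -> (X (a i) <-> I i).
  move=> Hchi Xm aI; exists (upd a n m); split=> // i.
  by rewrite ltnS leq_eqVlt /upd; case: eqP => [->|_ /aI].
have [In|nIn] := pselect (I n).
  have [m [Xm Hm]] : exists m, S m.
    apply: contrapT => S0; apply: nS; apply: sub_approximable approximable0.
    by move=> m Sm; apply: S0; exists m.
  move/vsat_subst_const/IH: Hm => [a [Ha aI]].
  by apply: (extend a m) => //; exact/vsat_subst_const.
apply: contrapT => nH; apply: nS.
exists V, (vren (subst_at n inl inr) chi) => X0 X0fin X0S.
(* The conjunction of [chi] with its [n]-th tuple set to each [m] in [X0] holds of the earlier
   generic terms; the induction hypothesis moves these terms into [M]. *)
have [g gE] := vbigand (inl m0 : V)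
  (finite_image (fun m => vren (subst_const n m) chi) X0fin).
have [|a [Ha aI]] := IH g.
  by apply/gE => _ [m /X0S[_ Hm] <-]; exact/vsat_subst_const.
exists (env id a) => m.
  move=> X0m; apply/vsat_subst_free; apply/(@vsat_subst_const M id).
  by move/gE: Ha; apply; exists m.
move/vsat_subst_free => Hm; apply: contrapT => nXm; apply: nH.
exact: (extend a m).
Qed.

(** * A sequence shattered by [phi] when [X] is not approximable *)

Section IndependenceProperty.
Variables (q : nat) (phi : formula L (k + q)).

Definition literal (I : set nat) i : vform L (V + 'I_q) :=
  let f := VForm phi (fun s => match fintype.split s with
                               | inl l => inl (inr (i, l))
                               | inr l => inr l
                               end) in
  if `[< I i >] then f else vnot f.

Lemma vsat_literal (N : structure L) (h : M -> N) c y I i :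
  vsat (sumf (env h c) y) (literal I i) <->
  (sat phi [tuple of [tuple c i l | l < k] ++ [tuple y l | l < q]] <-> I i).
Proof.
pose f : vform L (V + 'I_q) :=
  VForm phi (fun s => match fintype.split s with
                      | inl l => inl (inr (i, l))
                      | inr l => inr l
                      end).
have Ef : vsat (sumf (env h c) y) f <->
    sat phi [tuple of [tuple c i l | l < k] ++ [tuple y l | l < q]].
  rewrite /vsat /=; set t := mktuple _; set u := tuple _.
  suff -> : t = u by [].
  apply: eq_from_tnth => s; rewrite tnth_mktuple -[s]splitK.
  case: (fintype.split s) => l /=.
    by rewrite splitl tnth_lshift tnth_mktuple.
  by rewrite splitr tnth_rshift tnth_mktuple.
rewrite /literal -/f -Ef; case: asboolP => Ii; first by tauto.
by rewrite vsat_not; tauto.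
Qed.

Lemma has_IP_of_not_approximable (T : theory L) (d : q.-tuple MM) :
  models MM T -> small K [set: nat] ->
  (forall m, X m <-> sat phi [tuple of [tuple j (m l) | l < k] ++ d]) ->
  ~ approximable X -> has_IP T phi.
Proof.
move=> MT Knat XE nX; have [m0] := carrier_inhabited M.
have [|c cP] := @generic_sequence (j m0) Knat _ nX; first by exists m0.
(* Literals contain no constants of [M], so all constants may be sent to the single point [j m0];
   this keeps the parameter set countable. *)
have fin I n : exists y, forall i, i < n ->
    vsat (sumf (env (fun=> j m0) c) y) (literal I i).
  have Qfin : finite_set (literal I @` `I_n) by exact: finite_image (finite_II n).
  have [g gE] := vbigand (inl (inl m0) : V + 'I_q) Qfin.
  have [y Hy] : exists y, vsat (sumf (env j (trunc (j m0) c n)) y) g.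
    (* Otherwise the absence of a suitable [y] would hold of some [a] in [M] with membership pattern
       [I], although [d] is such a [y] for [a]. *)
    apply: contrapT => ng.
    have : vsat (env j (trunc (j m0) c n)) (vall (inl m0) (vnot g)).
      by apply/vsat_all => y /= Hy; apply: ng; exists y.
    move=> /(generic_patterns I cP)[a [/(vsat_elementary _ _ jE)]].
    have -> : j \o env id a = env j (fun i => j \o a i).
      by apply/funext => -[|[]].
    move=> /vsat_all/(_ (tnth d))/vsat_not na aI; apply: na.
    apply/gE => _ [i ilt <-]; apply/vsat_literal; rewrite -(aI i ilt) XE.
    by have -> : [tuple tnth d l | l < q] = d
      by apply: eq_from_tnth => l; rewrite tnth_mktuple.
  exists y => i ilt; move/gE: Hy => /(_ (literal I i)) Hy.
  have /vsat_literal : vsat (sumf (env j (trunc (j m0) c n)) y) (literal I i).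
    by apply: Hy; exists i.
  by rewrite /trunc ilt => Hi; apply/vsat_literal.
have cK : small K (range (env (fun=> j m0) c)).
  apply: sub_small Knat.
  pose e (o : option (nat * 'I_k)) := if o is Some p then c p.1 p.2 else j m0.
  apply: (@card_le_trans _ _ _ [set: option (nat * 'I_k)]); last exact/countableP.
  apply: card_le_trans (card_image_le e _); apply: subset_card_le.
  by move=> _ [[m|p] _ <-]; [exists None | exists (Some p)].
have b I : exists y, forall i, vsat (sumf (env (fun=> j m0) c) y) (literal I i).
  have [Q Qfin QF|y yF] := @saturated_vform L V q K MM _ (inl m0)
      (range (literal I)) satMM cK; last by exists y => i; apply: yF; exists i.
  (* Finitely many literals concern an initial segment of the sequence, which [fin] handles. *)
  have [n Qn] : exists n, Q `<=` literal I @` `I_n.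
    move: Q Qfin QF; apply: finite_set_ind => [_|f Q _ IH QF].
      by exists 0; exact: sub0set.
    have [|n Qn] := IH; first by move=> g Qg; apply: QF; right.
    have [i _ <-] := QF f (or_introl erefl).
    exists (maxn n i.+1) => g [->|/Qn[l /= ln <-]].
      by exists i => //=; rewrite leq_max leqnn orbT.
    by exists l => //=; rewrite leq_max ln.
  have [y Hy] := fin I n.
  by exists y => f /Qn[i ilt <-]; exact: Hy.
have [y Hy] := choice b.
exists MM; split=> //.
exists (fun i => [tuple c i l | l < k]), (fun I => [tuple y I l | l < q]) => i I.
by apply/(vsat_literal (fun=> j m0)); exact: Hy.
Qed.

End IndependenceProperty.

End HonestDefinitions.

Theorem proposition1p7 (L : language) (T : theory L) (K : Type)
    (M MM : structure L) (j : M -> MM) :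
  NIP T -> models M T ->
  monster_model K T MM -> small K [set: M] -> elementary j ->
  forall (k : nat) (X : set (k.-tuple M)),
    externally_definable j X ->
    exists f : pformula L MM k, honest_definition j f X.
Proof.
move=> nip _ [MT KL satMM _] KM jE k X [[q phi d] phiX].
(* The formulas [Fal L n] are pairwise distinct, so there are at least countably many formulas. *)
have Knat : small K [set: nat].
  have /injfunPex[g] : exists2 g : nat -> {n & formula L n},
      set_fun setT setT g & set_inj setT g.
    by exists (fun n => existT _ n (Fal L n)) => // n n' _ _ [].
  exact: sub_small (inj_card_le g) KL.
pose X' : set ('I_k -> M) := [set m | X [tuple m l | l < k]].
have mapE (m : 'I_k -> M) :
    map_tuple j [tuple m l | l < k] = [tuple j (m l) | l < k].
  by apply: eq_from_tnth => l; rewrite tnth_map !tnth_mktuple.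
have X'E m : X' m <-> sat phi [tuple of [tuple j (m l) | l < k] ++ d].
  have -> : X' m = psat (PFormula phi d) (map_tuple j [tuple m l | l < k]).
    by rewrite /X' -phiX.
  by rewrite mapE.
have [f [fX fH]] :=
  honest_of_approximable satMM KM jE (contrapT (fun nX =>
    nip _ _ _ (has_IP_of_not_approximable satMM KM jE MT Knat X'E nX))).
have tE (a : k.-tuple M) : [tuple tnth a l | l < k] = a.
  by apply: eq_from_tnth => l; rewrite tnth_mktuple.
exists f; split=> [|psi Xpsi x fx].
  apply/seteqP; split=> a; have := fX (tnth a);
    by rewrite -mapE /X' /= tE /trace /= => ->.
apply/vsat_vform_of_pform/fH => // m Xm.
(* The inclusion of [X] in the trace of [psi] is stated in the monster model, while [fH] asks for it
   in [M]. *)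
apply/(vsat_elementary _ _ jE).
have -> : j \o sumf id m = sumf j (tnth [tuple j (m l) | l < k]).
  by rewrite tnth_mktupleE; apply/funext => -[].
by apply/vsat_vform_of_pform; rewrite -mapE; exact: Xpsi.
Qed.
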